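(* Let $\alpha=[0,a_1,\ldots,a_n]$ be a rational number in $(0,1)$ with positive integers $a_1,\ldots,a_n$, and set $\alpha_0=0$, $\alpha_j=[0,a_1,\ldots,a_j]$ for $1\le j\le n$. Let $t_\alpha(\Delta_j)$ be the signs associated with $\alpha$ and its expansion. If $n=2$, then $t_\alpha(\Delta_2)=(-1)^{a_1}$ and $t_\alpha(\Delta_1)=(-1)^{a_1a_2+a_2+1}$. If $n\ge 3$, then: (1) If $\alpha_{n-2}$ is of $\frac11$-type and $\alpha_{n-1}$ is of $\frac10$-type, then $t_\alpha(\Delta_j)=(-1)^{d(\alpha_{j-1})(a_n-1)}\,t_{\alpha_{n-1}}(\Delta_j)$ for $1\le j\le n-1$, and $t_\alpha(\Delta_n)=t_{\alpha_{n-1}}(\Delta_{n-1})$. (2) If $\alpha_{n-2}$ is of $\frac01$-type and $\alpha_{n-1}$ is of $\frac10$-type, then $t_\alpha(\Delta_j)=(-1)^{d(\alpha_{j-1})a_n}\,t_{\alpha_{n-1}}(\Delta_j)$ for $1\le j\le n-1$, and $t_\alpha(\Delta_n)=-t_{\alpha_{n-1}}(\Delta_{n-1})$. (3) If $\alpha_{n-2}$ is of $\frac10$-type and $\alpha_{n-1}$ is of $\frac01$-type, then: - if $a_n$ is even, $t_\alpha(\Delta_j)=t_{\alpha_{n-1}}(\Delta_j)$ for $1\le j\le n-1$, and $t_\alpha(\Delta_n)=-t_{\alpha_{n-1}}(\Delta_{n-1})$; - if $a_n$ is odd, $t_\alpha(\Delta_j)=(-1)^{d(\alpha_{j-1})}\,t_{\alpha_{n-2}}(\Delta_j)$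 for $1\le j\le n-2$, and $t_\alpha(\Delta_j)=(-1)^{a_{n-1}-1}\,t_{\alpha_{n-2}}(\Delta_{n-2})$ for $j=n-1,n$. (4) If $\alpha_{n-2}$ is of $\frac11$-type and $\alpha_{n-1}$ is of $\frac01$-type, then: - if $a_n$ is even, $t_\alpha(\Delta_j)=t_{\alpha_{n-2}}(\Delta_j)$ for $1\le j\le n-2$, and $t_\alpha(\Delta_j)=(-1)^{a_{n-1}}\,t_{\alpha_{n-2}}(\Delta_{n-2})$ for $j=n-1,n$; - if $a_n$ is odd, $t_\alpha(\Delta_j)=t_{\alpha_{n-1}}(\Delta_j)$ for $1\le j\le n-1$, and $t_\alpha(\Delta_n)=t_{\alpha_{n-1}}(\Delta_{n-1})$. (5) If $\alpha_{n-2}$ is of $\frac01$-type and $\alpha_{n-1}$ is of $\frac11$-type, then $t_\alpha(\Delta_j)=t_{\alpha_{n-2}}(\Delta_j)$ for $1\le j\le n-2$, and $t_\alpha(\Delta_j)=(-1)^{a_{n-1}}\,t_{\alpha_{n-2}}(\Delta_{n-2})$ for $j=n-1,n$. (6) If $\alpha_{n-2}$ is of $\frac10$-type and $\alpha_{n-1}$ is of $\frac11$-type, then $t_\alpha(\Delta_j)=t_{\alpha_{n-2}}(\Delta_j)$ for $1\le j\le n-2$, and $t_\alpha(\Delta_j)=(-1)^{a_{n-1}}\,t_{\alpha_{n-2}}(\Delta_{n-2})$ for $j=n-1,n$. Here $d(\alpha_j)\in\{0,1\}$ is the denominator of the type of $\alpha_j$ (in particular $d(\alpha_0)=1$).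
   Context: $[0,a_1,\ldots,a_n]$ denotes the continued fraction $\cfrac{1}{a_1+\cfrac{1}{\ddots+\cfrac{1}{a_n}}}$. **Types.** An irreducible fraction $\frac pq$ (including $\frac10$) is of $\frac11$-, $\frac10$- or $\frac01$-type according to $(p,q)\equiv(1,1),(1,0),(0,1)\pmod 2$; $d(\frac pq)\in\{0,1\}$ is $q$ mod $2$. **Parents and triangles.** Irreducible fractions $\frac ab,\frac ce$ (nonnegative denominators) are Farey neighbors if $bc-ae=1$; their mediant is $\frac{a+c}{b+e}$. Every positive rational is the mediant of a unique pair of Farey neighbors, its parents (e.g. the parents of $\frac11$ are $\frac01,\frac10$). Let $\alpha=[0,a_1,\ldots,a_n]\in(0,1]$, $\alpha_{-1}=\frac10$, $\alpha_0=\frac01$, $\alpha_j=[0,a_1,\ldots,a_j]$. For fractions write $\frac ab\oplus k\frac ce=\frac{a+kc}{b+ke}$. Yamada's ancestor triangle $\mathrm{YAT}(\alpha)$ is the triangulated region which is the union of $\Delta_1,\ldots,\Delta_n$, where $\Delta_j$ is the fan of $a_j$ Farey triangles with vertices $\alpha_{j-1},\ \alpha_{j-2}\oplus k\alpha_{j-1},\ \alpha_{j-2}\oplus(k+1)\alpha_{j-1}$ ($0\le k<a_j$); thus $\Delta_j$ is a big triangle with corners $\alpha_{j-2},\alpha_{j-1},\alpha_j$. The continued fraction path $\alpha_0\to\alpha_1\to\cdots\to\alpha_n$ divides $\mathrm{YAT}(\alpha)$ into $\Delta_1,\ldots,\Delta_n$; the common edge of $\Delta_{j-1}$ and $\Delta_j$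 ($2\le j\le n$) is the edge joining $\alpha_{j-2}$ and $\alpha_{j-1}$. **Seifert path.** A downward path in $\mathrm{YAT}(\alpha)$ goes along edges $u\to v$ with $u$ a parent of $v$, the edge $\frac10\to\frac01$ being also allowed. A Seifert path of $\alpha$ is a downward path from $\frac10$ to $\alpha$ such that either every edge joins a vertex of $\frac10$-type and one of $\frac11$-type, or every edge joins a vertex of $\frac10$-type and one of $\frac01$-type. If the denominator of $\alpha$ is odd, the Seifert path is unique; if it is even there are exactly two. Let $\gamma_\alpha$ be the unique Seifert path when the denominator of $\alpha$ is odd, and the one with vertices of $\frac10$- and $\frac01$-types when $\alpha$ is of $\frac10$-type. **Signs.** $t_\alpha(\Delta_1)=-1$ if $\alpha$ is of $\frac10$- or $\frac01$-type, and $t_\alpha(\Delta_1)=1$ if $\alpha$ is of $\frac11$-type. For $2\le j\le n$, $t_\alpha(\Delta_j)=-t_\alpha(\Delta_{j-1})$ if $\gamma_\alpha$ contains the common edge of $\Delta_{j-1}$ and $\Delta_j$, and $t_\alpha(\Delta_j)=t_\alpha(\Delta_{j-1})$ otherwise. For $k<n$, the signs $t_{\alpha_k}(\Delta_j)$, $1\le j\le k$, are defined in the same way using $\alpha_k=[0,a_1,\ldots,a_k]$. *)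

(* Defs.v *)
From mathcomp Require Import all_boot all_order all_algebra.
From Stdlib Require Import ClassicalEpsilon.

Set Implicit Arguments.
Unset Strict Implicit.
Unset Printing Implicit Defensive.

Import Order.TTheory GRing.Theory Num.Theory.

Local Open Scope nat_scope.

(* [contfrac [:: a_1; ...; a_n]] is the rational [0, a_1, ..., a_n];
   the empty list gives 0. *)
Fixpoint contfrac (a : seq nat) : rat :=
  if a is x :: s then ((x%:R + contfrac s)^-1)%R else 0%R.

(* Fractions p/q with p, q >= 0 are pairs (p, q), so that 1/0 is available.
   [frac_of] gives the irreducible fraction of a nonnegative rational. *)
Definition frac : Type := (nat * nat)%type.

Definition frac_of (x : rat) : frac := (`|numq x|%N, `|denq x|%N).

Definition ftype (x : frac) : nat * nat := (x.1 %% 2, x.2 %% 2).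

Definition d (x : frac) : nat := x.2 %% 2.

Definition T11 : nat * nat := (1, 1).
Definition T10 : nat * nat := (1, 0).
Definition T01 : nat * nat := (0, 1).

(* For a/b = x and c/e = y this reads bc - ae = 1. *)
Definition farey_neighbors (x y : frac) : Prop := x.2 * y.1 = x.1 * y.2 + 1.

(* x (+) k y; the mediant of x and y is [oplus x 1 y]. *)
Definition oplus (x : frac) (k : nat) (y : frac) : frac :=
  (x.1 + k * y.1, x.2 + k * y.2).

Definition parents (x y v : frac) : Prop :=
  farey_neighbors x y /\ v = oplus x 1 y.

Definition parent (u v : frac) : Prop :=
  exists w, parents u w v \/ parents w u v.

(* a_j, for 1 <= j <= n. *)
Definition part (a : seq nat) (j : nat) : nat := nth 0 a j.-1.

(* alpha_j, for 0 <= j <= n. *)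
Definition alpha_ (a : seq nat) (j : nat) : frac :=
  frac_of (contfrac (take j a)).

(* [alpha_pred a i] is alpha_{i-1}; the shift accommodates alpha_{-1} = 1/0. *)
Definition alpha_pred (a : seq nat) (i : nat) : frac :=
  if i is i'.+1 then alpha_ a i' else (1, 0).

(* The k-th Farey triangle of Delta_j, given by its vertices alpha_{j-1},
   alpha_{j-2} (+) k alpha_{j-1} and alpha_{j-2} (+) (k+1) alpha_{j-1}. *)
Definition triangle (a : seq nat) (j k : nat) : seq frac :=
  [:: alpha_pred a j;
      oplus (alpha_pred a j.-1) k (alpha_pred a j);
      oplus (alpha_pred a j.-1) k.+1 (alpha_pred a j)].

Definition Delta (a : seq nat) (j : nat) : seq (seq frac) :=
  [seq triangle a j k | k <- iota 0 (part a j)].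

Definition YAT (a : seq nat) : seq (seq frac) :=
  flatten [seq Delta a j | j <- iota 1 (size a)].

Definition YAT_edge (a : seq nat) (u v : frac) : Prop :=
  u <> v /\ exists2 t, t \in YAT a & (u \in t) && (v \in t).

Definition downward_edge (a : seq nat) (u v : frac) : Prop :=
  YAT_edge a u v /\ (parent u v \/ (u = (1, 0) /\ v = (0, 1))).

(* A path is the list of its successive vertices. *)
Definition edges (g : seq frac) : seq (frac * frac) := zip g (behead g).

Definition downward_path (a : seq nat) (x y : frac) (g : seq frac) : Prop :=
  [/\ ohead g = Some x, last x g = y &
      forall e, e \in edges g -> downward_edge a e.1 e.2].

Definition contains_edge (g : seq frac) (u v : frac) : bool :=
  ((u, v) \in edges g) || ((v, u) \in edges g).

Definition joins_types (S T : nat * nat) (e : frac * frac) : Prop :=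
  (ftype e.1 = S /\ ftype e.2 = T) \/ (ftype e.1 = T /\ ftype e.2 = S).

Definition seifert_path_of (T : nat * nat) (a : seq nat) (g : seq frac) : Prop :=
  downward_path a (1, 0) (alpha_ a (size a)) g /\
  forall e, e \in edges g -> joins_types T10 T e.

Definition seifert_path (a : seq nat) (g : seq frac) : Prop :=
  seifert_path_of T11 a g \/ seifert_path_of T01 a g.

(* gamma_alpha is the path characterized by [is_gamma], picked by
   [epsilon]. *)
Definition is_gamma (a : seq nat) (g : seq frac) : Prop :=
  if ftype (alpha_ a (size a)) == T10 then seifert_path_of T01 a g
  else seifert_path a g.

Definition gamma (a : seq nat) : seq frac :=
  epsilon (inhabits [::]) (is_gamma a).

(* [t a j] is t_alpha(Delta_j) for alpha = [0, a_1, ..., a_n] and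
   1 <= j <= n (the value at j = 0 is irrelevant).  The common edge of
   Delta_{j-1} and Delta_j joins alpha_{j-2} and alpha_{j-1}. *)
Fixpoint t (a : seq nat) (j : nat) : int :=
  match j with
  | 0 | 1 => (if ftype (alpha_ a (size a)) == T11 then 1 else -1)%R
  | (i.+1 as j').+1 =>
      if contains_edge (gamma a) (alpha_ a i) (alpha_ a j')
      then (- t a j')%R else t a j'
  end.

(* Main.v *)
Require Import Defs.
From mathcomp Require Import all_boot all_order all_algebra.
From mathcomp Require Import zify.
From Stdlib Require Import ClassicalEpsilon.

(** The proof rests on the fact that a Seifert path sees the types of the
    convergents and nothing else.  A Seifert path uses the vertices of two
    types, 1/0 and T, where T is 1/1 or 0/1.  The two parents of a vertex and
    the vertex itself have three different types, so that a vertex on the path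
    has exactly one parent that can precede it: the path is determined by its
    end and can be traced backwards ([seifert_path_of_uniq]).  Arriving at
    alpha_k, the trace goes to the parent alpha_{k-1} if that has type 1/0 or
    T; otherwise it descends the whole fan around alpha_{k-1}, whose outer
    vertices alternate between 1/0 and T, and arrives at alpha_{k-2}
    ([seifert_descent_exists]).  Hence the path visits every convergent of
    type 1/0 or T, and it contains the edge from alpha_j to alpha_{j+1} if and
    only if both ends have one of these types ([contains_edge_gamma]).

    Consequently t_alpha(Delta_j) is a sign [type_sign T a j] on which the
    partial quotients from a_j on act only through T ([t_type_sign]).  If alpha
    and one of its convergents have the same T, then their signs agree.
    Otherwise one compares the signs for 1/1 and 0/1.  Their ratio is -1 on
    Delta_1, and it changes between two consecutive triangles exactly when one
    of the two convergents on the common edge has type 1/0.  So the ratio on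
    Delta_j is (-1)^d(alpha_{j-1}) ([type_sign_compare]).

    Finally alpha_{k+2} = alpha_k (+) a_{k+2} alpha_{k+1} modulo 2 gives the
    type of alpha_n from those of alpha_{n-2} and alpha_{n-1}, and, read
    backwards, the type of alpha_{n-3}.  The parities of a_n and a_{n-1}
    therefore decide T and the changes of sign at the last two edges, which
    leaves a finite check in each case. *)

Set Implicit Arguments.
Unset Strict Implicit.
Unset Printing Implicit Defensive.

Import Order.TTheory GRing.Theory Num.Theory.

Local Open Scope nat_scope.

(** * Farey neighbors and parents *)

Definition adjacent (x y : Defs.frac) : Prop :=
  farey_neighbors x y \/ farey_neighbors y x.

Lemma adjacentC x y : adjacent x y -> adjacent y x.
Proof. by case; [right | left]. Qed.

Lemma adjacent_oplus x m y : adjacent x y -> adjacent (oplus x m y) y.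
Proof. by rewrite /adjacent /farey_neighbors /oplus /=; nia. Qed.

Lemma oplusS x m y : oplus x m.+1 y = oplus (oplus x m y) 1 y.
Proof. by rewrite /oplus /=; congr pair; lia. Qed.

Lemma oplus0 x y : oplus x 0 y = x.
Proof. by rewrite /oplus !mul0n !addn0 -surjective_pairing. Qed.

Lemma oplus1C x y : oplus x 1 y = oplus y 1 x.
Proof. by rewrite /oplus !mul1n; congr pair; exact: addnC. Qed.

Lemma parentE u v :
  parent u v <-> exists2 w, adjacent u w & v = oplus u 1 w.
Proof.
split=> [[w [[uw ->]|[wu ->]]] | [w [uw|wu] ->]].
- by exists w => //; left.
- by exists w; [right | rewrite oplus1C].
- by exists w; left.
- by exists w; right; split; rewrite // oplus1C.
Qed.

Lemma parent_oplus x m y :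
  adjacent x y -> parent (oplus x m y) (oplus x m.+1 y).
Proof.
move=> xy; apply/parentE; exists y; first exact: adjacent_oplus.
exact: oplusS.
Qed.

Lemma parent_oplus_fixed x m y : adjacent x y -> parent y (oplus x m.+1 y).
Proof.
move=> xy; apply/parentE; exists (oplus x m y).
  exact/adjacentC/adjacent_oplus.
by rewrite oplusS oplus1C.
Qed.

Lemma parent_neq u v : parent u v -> u <> v.
Proof.
move=> /parentE [[c e] adj ->]; case: u adj => a b.
by rewrite /adjacent /farey_neighbors /oplus /= => adj [? ?]; nia.
Qed.

(** If bc - ae = 1, then with p = a + c and q = b + e the fraction p/q satisfies
    bp - aq = 1.  So b is determined modulo q, and it lies in [1, q]. *)
Lemma parents_inj u w u' w' :
  farey_neighbors u w -> farey_neighbors u' w' ->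
  oplus u 1 w = oplus u' 1 w' -> u = u' /\ w = w'.
Proof.
case: u w u' w' => [a b] [c e] [a' b'] [c' e'].
rewrite /farey_neighbors /oplus /= !mul1n => F F' [Ep Eq].
have b_gt0 : 0 < b by nia.
have b'_gt0 : 0 < b' by nia.
(* Multiply b by b'p - a'q = 1 and b' by bp - aq = 1, and subtract. *)
have H : b + (b + e) * (a' * b) = b' + (b + e) * (a * b') by nia.
have Eb : b = b' by case: (ltngtP (a' * b) (a * b')) => ?; nia.
have Ea : a = a' by nia.
by split; congr pair; lia.
Qed.

(** * Types *)

(** All statements about types concern finitely many parities, so that they
    reduce to a truth table. *)
Ltac by_parity :=
  repeat match goal with |- context [odd ?n] => case: (odd n) end.

Lemma ftypeE x : ftype x = (nat_of_bool (odd x.1), nat_of_bool (odd x.2)).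
Proof. by rewrite /ftype !modn2. Qed.

(** The Farey determinant is 1 or -1.  Its parity alone excludes the type
    (0, 0) and makes the types of adjacent fractions different. *)
Lemma adjacent_odd x y : adjacent x y ->
  (odd x.2 && odd y.1) (+) (odd x.1 && odd y.2).
Proof.
by case=> /(congr1 odd); rewrite /= oddD !oddM addbT; by_parity.
Qed.

(** * Uniqueness of Seifert paths *)

Definition seifert_type (T : nat * nat) (v : Defs.frac) : bool :=
  (ftype v == T10) || (ftype v == T).

Lemma joins_typesE T u v : adjacent u v ->
  seifert_type T u -> seifert_type T v -> joins_types T10 T (u, v).
Proof.
move=> uv.
have neq : ftype u != ftype v.
  by have := adjacent_odd uv; rewrite !ftypeE; by_parity.
rewrite /seifert_type /joins_types /= => /orP[] /eqP Eu /orP[] /eqP Ev.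
all: by move: neq; rewrite Eu Ev ?eqxx //; auto.
Qed.

(** If y has the third type, then adding it exchanges 1/0 and T: the outer
    vertices of the fan around y alternate between these two types. *)
Lemma seifert_type_oplus T x m y : T = T11 \/ T = T01 -> adjacent x y ->
  seifert_type T x -> ~~ seifert_type T y -> seifert_type T (oplus x m y).
Proof.
move=> HT /adjacent_odd; rewrite /seifert_type !ftypeE /= !oddD !oddM.
by case: HT => ->; by_parity.
Qed.

(** Each of u and u' has the type among 1/0 and T that v does not have.  The
    parents of v are adjacent and hence of different types, so u and u' are
    the same parent. *)
Lemma seifert_parent_inj T u u' v : T <> T10 ->
  parent u v -> joins_types T10 T (u, v) ->
  parent u' v -> joins_types T10 T (u', v) -> u = u'.
Proof.
move=> T10' /parentE [w uw ->] J /parentE [w' uw' E] J'.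
have Et : ftype u = ftype u'.
  move: J J'; rewrite /joins_types /=.
  by case=> [] [-> ->]; case=> [] [-> E'] //; case: T10'.
have clash x y : adjacent x y -> ftype x <> ftype y.
  by move/adjacent_odd; rewrite !ftypeE; by_parity.
case: uw uw' => F [] F'.
- by case: (parents_inj F F' E).
- rewrite (oplus1C u') in E; case: (parents_inj F F' E) => _ Ew.
  by case: (@clash u w); [left | rewrite Ew].
- rewrite (oplus1C u) in E; case: (parents_inj F F' E) => Ew _.
  by case: (@clash u w); [right | rewrite Ew].
- rewrite (oplus1C u) (oplus1C u') in E.
  by case: (parents_inj F F' E).
Qed.

Lemma no_parent10 u : ~ parent u (1, 0).
Proof.
move=> /parentE [[c e]]; case: u => a b.
by rewrite /adjacent /farey_neighbors /oplus /= => adj [? ?]; nia.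
Qed.

Lemma no_parent01 u : ~ parent u (0, 1).
Proof.
move=> /parentE [[c e]]; case: u => a b.
by rewrite /adjacent /farey_neighbors /oplus /= => adj [? ?]; nia.
Qed.

Lemma downward_edge_neq10 a u v : downward_edge a u v -> v <> (1, 0).
Proof.
by move=> [_ [uv E | [_ -> //]]]; move: uv; rewrite E; exact: no_parent10.
Qed.

Lemma seifert_edge_inj a T u u' v : T <> T10 ->
  downward_edge a u v -> joins_types T10 T (u, v) ->
  downward_edge a u' v -> joins_types T10 T (u', v) -> u = u'.
Proof.
move=> T10' [_ D] J [_ D'] J'.
case: D => [P|[-> Ev]]; case: D' => [P'|[-> Ev']] //.
- exact: seifert_parent_inj P J P' J'.
- by case: (@no_parent01 u); rewrite -Ev'.
- by case: (@no_parent01 u'); rewrite -Ev.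
Qed.

Lemma edges_rcons x s v :
  edges (x :: rcons s v) = rcons (edges (x :: s)) (last x s, v).
Proof.
rewrite /edges /=; elim: s x => [|y s IH] x //=; by rewrite IH.
Qed.

Lemma seifert_path_ofE T a g : seifert_path_of T a g ->
  exists s, [/\ g = (1, 0) :: s, last (1, 0) s = alpha_ a (size a) &
    forall e, e \in edges ((1, 0) :: s) ->
      downward_edge a e.1 e.2 /\ joins_types T10 T e].
Proof.
case=> [[]]; case: g => [|x s] //= [->] El D J; exists s; split=> // e es.
by split; [exact: D | exact: J].
Qed.

(** The two paths are compared from their common end backwards.  They have the
    same length because no downward edge ends at 1/0. *)
Lemma seifert_path_of_uniq T a g g' : T <> T10 ->
  seifert_path_of T a g -> seifert_path_of T a g' -> g = g'.
Proof.
move=> T10' /seifert_path_ofE [s [-> El Es]].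
move=> /seifert_path_ofE [s' [-> El' Es']].
congr cons; rewrite -{}El' in El.
elim/last_ind: s s' El Es Es' => [|s v IH] s' El Es Es'.
  case/lastP: s' El Es' => [//|s' v']; rewrite last_rcons edges_rcons.
  move=> <- /(_ (last (1, 0) s', (1, 0))); rewrite mem_rcons mem_head.
  by move=> /(_ isT) [/downward_edge_neq10].
have Dv : downward_edge a (last (1, 0) s) v /\
           joins_types T10 T (last (1, 0) s, v).
  by apply: (Es (_, _)); rewrite edges_rcons mem_rcons mem_head.
case/lastP: s' El Es' => [|s' v']; rewrite last_rcons ?last_rcons => Ev.
  by case: Dv => /downward_edge_neq10; rewrite Ev.
rewrite -{}Ev => Es'.
have Dv' : downward_edge a (last (1, 0) s') v /\
            joins_types T10 T (last (1, 0) s', v).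
  by apply: (Es' (_, _)); rewrite edges_rcons mem_rcons mem_head.
congr rcons; apply: IH.
- by case: Dv Dv' => D J [D' J']; exact: seifert_edge_inj D J D' J'.
- by move=> e es; apply: Es; rewrite edges_rcons mem_rcons inE es orbT.
- by move=> e es; apply: Es'; rewrite edges_rcons mem_rcons inE es orbT.
Qed.

(** * Convergents *)

(** The numerator and denominator of [contfrac s], computed from the front:
    1 / (x + p/q) = q / (x q + p). *)
Fixpoint continuant (s : seq nat) : Defs.frac :=
  if s is x :: s' then
    ((continuant s').2, x * (continuant s').2 + (continuant s').1)
  else (0, 1).

Lemma continuantP s : all (leq 1) s ->
  [/\ 0 < (continuant s).2, coprime (continuant s).1 (continuant s).2 &
      contfrac s = ((continuant s).1%:R / (continuant s).2%:R)%R].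
Proof.
elim: s => [|x s IH] /=; first by rewrite mul0r.
move=> /andP[x_gt0 /IH [q_gt0 co ->]]; split; first nia.
  by rewrite /coprime gcdnMDl -/(coprime _ _) coprime_sym.
rewrite natrD natrM.
have q0 : ((continuant s).2%:R != 0 :> rat)%R by rewrite pnatr_eq0 -lt0n.
by rewrite -[X in (X + _ / _)%R](mulfK q0) -mulrDl invf_div.
Qed.

Lemma frac_of_contfrac s : all (leq 1) s -> frac_of (contfrac s) = continuant s.
Proof.
move=> /continuantP [q_gt0 co ->]; rewrite /frac_of [RHS]surjective_pairing.
congr pair.
  have := @coprimeq_num (continuant s).1%:Z (continuant s).2%:Z co.
  by rewrite !pmulrn => ->; rewrite gtr0_sg ?mul1r.
have := @coprimeq_den (continuant s).1%:Z (continuant s).2%:Z co.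
by rewrite !pmulrn => ->; rewrite eqz_nat (negPf (lt0n_neq0 q_gt0)).
Qed.

(** The recursion from the back.  Prepending an entry acts linearly on the
    pairs (p, q), so the relation is inherited from the empty prefix. *)
Lemma continuant_recur s b c :
  continuant (rcons (rcons s b) c) =
    oplus (continuant s) c (continuant (rcons s b)).
Proof.
by elim: s => [|x s IH]; rewrite /= ?IH /oplus /=; congr pair; nia.
Qed.

Section Convergents.
Variable a : seq nat.
Hypothesis a_gt0 : all (leq 1) a.

Lemma alpha_continuant j : alpha_ a j = continuant (take j a).
Proof.
rewrite /alpha_ frac_of_contfrac //; apply/allP => x /mem_take.
exact: (allP a_gt0).
Qed.

Lemma alpha_pred_recur k : k < size a ->
  alpha_pred a k.+2 =
    oplus (alpha_pred a k) (part a k.+1) (alpha_pred a k.+1).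
Proof.
move=> lt_k; rewrite /part /= !alpha_continuant (take_nth 0 lt_k).
case: k lt_k => [|k] lt_k /=; first by rewrite take0 /oplus /=; congr pair; lia.
by rewrite alpha_continuant (take_nth 0 (ltnW lt_k)) continuant_recur.
Qed.

Lemma part_gt0 k : k < size a -> 0 < part a k.+1.
Proof. by move=> lt_k; apply: (allP a_gt0); exact: mem_nth. Qed.

Lemma alpha_pred1 : alpha_pred a 1 = (0, 1).
Proof. by rewrite /= alpha_continuant take0. Qed.

Lemma alpha_pred_adjacent k : k <= size a ->
  adjacent (alpha_pred a k) (alpha_pred a k.+1).
Proof.
elim: k => [|k IH] lt_k; first by rewrite alpha_pred1; right.
by rewrite alpha_pred_recur //; apply/adjacentC/adjacent_oplus/IH/ltnW.
Qed.

Lemma triangle_YAT k m : k < size a -> m < part a k.+1 ->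
  triangle a k.+1 m \in YAT a.
Proof.
move=> lt_k lt_m; apply/flatten_mapP; exists k.+1.
  by rewrite mem_iota; lia.
by apply/mapP; exists m; rewrite // mem_iota.
Qed.

Lemma downward_root : 0 < size a ->
  downward_edge a (1, 0) (alpha_pred a 1).
Proof.
move=> a0; split; last by right; rewrite alpha_pred1.
split; first by rewrite alpha_pred1.
exists (triangle a 1 0); first by rewrite triangle_YAT // part_gt0.
by rewrite /triangle !inE oplus0 /= !eqxx !orbT.
Qed.

Lemma downward_fan k m : k < size a -> m < part a k.+1 ->
  downward_edge a (oplus (alpha_pred a k) m (alpha_pred a k.+1))
                  (oplus (alpha_pred a k) m.+1 (alpha_pred a k.+1)).
Proof.
move=> lt_k lt_m; have adj := alpha_pred_adjacent (ltnW lt_k).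
have P := parent_oplus m adj.
split; last by left.
split; first exact: parent_neq.
exists (triangle a k.+1 m); first exact: triangle_YAT.
by rewrite /triangle !inE !eqxx !orbT.
Qed.

Lemma downward_convergent k : k < size a ->
  downward_edge a (alpha_pred a k.+1) (alpha_pred a k.+2).
Proof.
move=> lt_k; have adj := alpha_pred_adjacent (ltnW lt_k).
rewrite alpha_pred_recur //; have := part_gt0 lt_k.
case Em: (part a k.+1) => [//|m] _.
have P := parent_oplus_fixed m adj.
split; last by left.
split; first exact: parent_neq.
exists (triangle a k.+1 m); first by rewrite triangle_YAT // Em.
by rewrite /triangle !inE !eqxx !orbT.
Qed.

(** * Existence of Seifert paths *)

Variable T : nat * nat.
Hypothesis T_odd : T = T11 \/ T = T01.

(** The initial vertex 1/0 is left out of [s]. *)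
Definition seifert_descent (v : Defs.frac) (s : seq Defs.frac) : Prop :=
  last (1, 0) s = v /\
  forall e, e \in edges ((1, 0) :: s) ->
    downward_edge a e.1 e.2 /\ joins_types T10 T e.

Lemma seifert_descent_rcons u v s : seifert_descent u s ->
  downward_edge a u v -> adjacent u v ->
  seifert_type T u -> seifert_type T v -> seifert_descent v (rcons s v).
Proof.
move=> [El Es] D adj Tu Tv; split; first by rewrite last_rcons.
move=> e; rewrite edges_rcons mem_rcons inE El => /orP[/eqP -> /=|/Es //].
by split; last exact: joins_typesE.
Qed.

(** Write v_k for [alpha_pred a k].  The backward trace goes from v_k to v_{k-1}
    if that has an admissible type, and otherwise along the fan around v_{k-1}
    to v_{k-2}.  In the second case neither edge at v_{k-1} has two admissible
    ends, so the path may miss both. *)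
Lemma seifert_descent_exists k : 0 < size a -> k <= (size a).+1 ->
  seifert_type T (alpha_pred a k) ->
  exists2 s, seifert_descent (alpha_pred a k) s &
    forall j, j < k -> seifert_type T (alpha_pred a j) ->
      seifert_type T (alpha_pred a j.+1) ->
      (alpha_pred a j, alpha_pred a j.+1) \in edges ((1, 0) :: s).
Proof.
move=> a0; elim/ltn_ind: k => k IH le_k Tk.
case: k => [|k] in IH le_k Tk *; first by exists [::].
have adj : adjacent (alpha_pred a k) (alpha_pred a k.+1).
  exact: alpha_pred_adjacent.
have [Tk1|nTk1] := boolP (seifert_type T (alpha_pred a k)).
  have [s Ds Es] := IH k (ltnSn k) (ltnW le_k) Tk1.
  exists (rcons s (alpha_pred a k.+1)).
    apply: (@seifert_descent_rcons (alpha_pred a k)) => //.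
    by case: k le_k {IH Tk adj Tk1 Ds Es} => [|k] le_k;
      [exact: downward_root | exact: downward_convergent].
  move=> j; rewrite ltnS leq_eqVlt => /orP[/eqP -> _ _|lt_j Tj Tj1].
    by case: Ds => El _; rewrite edges_rcons El mem_rcons mem_head.
  by rewrite edges_rcons mem_rcons inE Es ?orbT.
case: k => [|k] in IH le_k Tk adj nTk1 *.
  by move: nTk1; rewrite /seifert_type.
have adj' : adjacent (alpha_pred a k) (alpha_pred a k.+1).
  by apply: alpha_pred_adjacent; lia.
have Tk0 : seifert_type T (alpha_pred a k).
  move: Tk nTk1 (@adjacent_odd _ _ adj'); rewrite alpha_pred_recur //.
  rewrite /seifert_type !ftypeE /= !oddD !oddM.
  by case: T_odd => ->; by_parity.
(* Extend the path along the outer vertices of the fan around v_{k+1}. *)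
have fan m : m <= part a k.+1 ->
  exists2 s, seifert_descent (oplus (alpha_pred a k) m (alpha_pred a k.+1)) s &
    forall j, j < k -> seifert_type T (alpha_pred a j) ->
      seifert_type T (alpha_pred a j.+1) ->
      (alpha_pred a j, alpha_pred a j.+1) \in edges ((1, 0) :: s).
  elim: m => [_|m IHm lt_m]; first by rewrite oplus0; apply: IH => //; lia.
  have [s Ds Es] := IHm (ltnW lt_m).
  exists (rcons s (oplus (alpha_pred a k) m.+1 (alpha_pred a k.+1))).
    apply: (seifert_descent_rcons Ds).
    - exact: downward_fan.
    - apply/adjacentC; rewrite oplusS oplus1C.
      exact/adjacent_oplus/adjacentC/adjacent_oplus.
    - exact: seifert_type_oplus.
    - exact: seifert_type_oplus.
  by move=> j lt_j Tj Tj1; rewrite edges_rcons mem_rcons inE Es ?orbT.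
have [s Ds Es] := fan _ (leqnn _).
exists s; first by rewrite alpha_pred_recur.
move=> j; rewrite ltnS leq_eqVlt => /orP[/eqP -> Tj|].
  by rewrite (negPf nTk1) in Tj.
by rewrite ltnS leq_eqVlt => /orP[/eqP -> _ Tj1|/Es//]; rewrite Tj1 in nTk1.
Qed.
End Convergents.

Local Open Scope ring_scope.

(** * The signs in terms of types *)

(** The type T for which gamma_alpha uses the types 1/0 and T, if [v] is
    alpha. *)
Definition path_type (v : Defs.frac) : nat * nat :=
  if ftype v == T11 then T11 else T01.

(** The signs of the fans, for a path that uses the types 1/0 and T and
    contains every edge of the continued fraction path with ends of these
    types. *)
Fixpoint type_sign (T : nat * nat) (a : seq nat) (j : nat) : int :=
  match j with
  | 0%N | 1%N => if T == T11 then 1 else -1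
  | (i.+1 as j').+1 =>
      if seifert_type T (alpha_ a i) && seifert_type T (alpha_ a j')
      then - type_sign T a j' else type_sign T a j'
  end.

Arguments type_sign : simpl never.
Arguments t : simpl never.

Lemma type_signSS T a j : type_sign T a j.+2 =
  if seifert_type T (alpha_ a j) && seifert_type T (alpha_ a j.+1)
  then - type_sign T a j.+1 else type_sign T a j.+1.
Proof. by []. Qed.

Lemma alpha_adjacent a j : all (leq 1) a -> (j < size a)%N ->
  adjacent (alpha_ a j) (alpha_ a j.+1).
Proof. by move=> a_gt0 lt_j; exact: (@alpha_pred_adjacent a a_gt0 j.+1). Qed.

Lemma alpha_recur a j : all (leq 1) a -> (j.+1 < size a)%N ->
  alpha_ a j.+2 = oplus (alpha_ a j) (part a j.+2) (alpha_ a j.+1).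
Proof. by move=> a_gt0 lt_j; exact: (@alpha_pred_recur a a_gt0 j.+1). Qed.

(** This excludes the second disjunct in the definition of [gamma]: an alpha
    that is not of type 1/0 has the type T of each of its Seifert paths. *)
Lemma seifert_path_of_end T a g : (0 < size a)%N ->
  seifert_path_of T a g -> seifert_type T (alpha_ a (size a)).
Proof.
move=> a0 /seifert_path_ofE [s [_ <- Es]].
case/lastP: s Es => [|s v] Es; first by rewrite /seifert_type.
have [|_] := Es (last (1, 0)%N s, v).
  by rewrite edges_rcons mem_rcons mem_head.
rewrite last_rcons /seifert_type.
by case=> [[_ /= ->]|[_ /= ->]]; rewrite eqxx ?orbT.
Qed.

Section Gamma.
Variable a : seq nat.
Hypotheses (a_gt0 : all (leq 1) a) (size_gt0 : (0 < size a)%N).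
Let T := path_type (alpha_ a (size a)).

Lemma path_type_odd : T = T11 \/ T = T01.
Proof. by rewrite /T /path_type; case: ifP; [left | right]. Qed.

Lemma path_type_end : seifert_type T (alpha_ a (size a)).
Proof.
have /alpha_adjacent : ((size a).-1 < size a)%N by rewrite prednK.
rewrite prednK // => /(_ a_gt0) /adjacent_odd.
rewrite /T /path_type /seifert_type !ftypeE.
by by_parity.
Qed.

Lemma seifert_path_exists : exists2 g, seifert_path_of T a g &
  forall j, (j.+1 < size a)%N ->
    seifert_type T (alpha_ a j) -> seifert_type T (alpha_ a j.+1) ->
    (alpha_ a j, alpha_ a j.+1) \in edges g.
Proof.
have [s [El Es] Ein] := seifert_descent_exists a_gt0 path_type_odd size_gt0
  (leqnn (size a).+1) path_type_end.
exists ((1, 0)%N :: s).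
  by split; [split=> // e /Es [] | move=> e /Es []].
by move=> j lt_j; apply: (Ein j.+1); exact: ltnW.
Qed.

Lemma gamma_seifert : seifert_path_of T a (gamma a).
Proof.
have [g Pg _] := seifert_path_exists.
have : is_gamma a (gamma a).
  apply: epsilon_spec; exists g; rewrite /is_gamma.
  case: ifP => [/eqP E10|_]; first by move: Pg; rewrite /T /path_type E10.
  by rewrite /seifert_path; case: path_type_odd => <-; [left | right].
rewrite /is_gamma /T /path_type; case: ifP => [/eqP -> //|N10].
by case=> P; have := seifert_path_of_end size_gt0 P;
  rewrite /seifert_type N10 => /eqP E; rewrite E.
Qed.

(** An edge of a Seifert path has ends of the types 1/0 and T.  Conversely the
    path constructed above contains all such edges, and it is gamma_alpha by
    uniqueness. *)
Lemma contains_edge_gamma j : (j.+1 < size a)%N ->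
  contains_edge (gamma a) (alpha_ a j) (alpha_ a j.+1) =
    seifert_type T (alpha_ a j) && seifert_type T (alpha_ a j.+1).
Proof.
move=> lt_j; apply/idP/andP => [|[Tj Tj1]].
  have [_ J] := gamma_seifert.
  rewrite /seifert_type; case/orP => /J [] [/= -> ->]; by rewrite !eqxx !orbT.
have [g Pg Ein] := seifert_path_exists.
have T10' : T <> T10 by case: path_type_odd => ->.
rewrite (seifert_path_of_uniq T10' gamma_seifert Pg).
by rewrite /contains_edge Ein.
Qed.

Lemma t_type_sign j : (j <= size a)%N -> t a j = type_sign T a j.
Proof.
have base : (if ftype (alpha_ a (size a)) == T11 then 1 else -1 : int) =
            if T == T11 then 1 else -1.
  by rewrite /T /path_type; case: ifP.
elim: j => [|[|j] IH] le_j; [exact: base | exact: base |].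
rewrite -[t a j.+2]/(if contains_edge _ _ _ then - t a j.+1 else t a j.+1).
by rewrite contains_edge_gamma // IH // ltnW.
Qed.

End Gamma.

Lemma alpha_take k a j : (j <= k)%N -> alpha_ (take k a) j = alpha_ a j.
Proof. by move=> le_j; rewrite /alpha_ take_takel. Qed.

Lemma type_sign_take T k a j : (j <= k)%N ->
  type_sign T (take k a) j = type_sign T a j.
Proof.
elim: j => [|[|j] IH] le_j //.
rewrite !type_signSS IH 1?ltnW //.
by rewrite !alpha_take // ?(ltnW le_j) // ltnW // ltnW.
Qed.

Lemma t_take k a j : all (leq 1) a -> (0 < k <= size a)%N -> (j <= k)%N ->
  t (take k a) j = type_sign (path_type (alpha_ a k)) a j.
Proof.
move=> a_gt0 /andP[k_gt0 le_k] le_j.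
have sz : size (take k a) = k by rewrite size_takel.
rewrite t_type_sign ?sz ?alpha_take ?type_sign_take //.
by apply/allP => x /mem_take; exact: (allP a_gt0).
Qed.

(** Adjacent convergents have two of the three types.  If one is 1/0, then
    exactly one of the two signs changes, and d changes too; if not, neither
    sign changes, and d is 1 at both. *)
Lemma type_sign_compare a j : all (leq 1) a -> (0 < j <= size a)%N ->
  type_sign T11 a j = (-1) ^+ d (alpha_ a (j - 1)) * type_sign T01 a j.
Proof.
move=> a_gt0; case: j => [//|j]; rewrite subn1 /= => lt_j.
elim: j lt_j => [|j IH] lt_j.
  by rewrite alpha_continuant // take0.
rewrite !type_signSS IH 1?ltnW //.
have := adjacent_odd (alpha_adjacent a_gt0 (ltnW lt_j)).
rewrite /seifert_type !ftypeE /d !modn2.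
by by_parity; rewrite //= ?expr0 ?expr1 ?mul1r ?mulN1r ?opprK.
Qed.

(** * Parity of the last partial quotients *)

(** The type of x (+) m y, where x and y have types [S] and [U]. *)
Definition type_step (S : nat * nat) (m : nat) (U : nat * nat) : nat * nat :=
  if odd m then ((S.1 + U.1) %% 2, (S.2 + U.2) %% 2)%N else S.

Lemma ftype_oplus x m y :
  ftype (oplus x m y) = type_step (ftype x) m (ftype y).
Proof.
by rewrite /type_step !ftypeE /= !oddD !oddM !modn2 !oddD !oddb; by_parity.
Qed.

(** Modulo 2, adding m y twice changes nothing. *)
Lemma ftype_oplus_back x m y :
  ftype x = type_step (ftype (oplus x m y)) m (ftype y).
Proof.
by rewrite /type_step !ftypeE /= !oddD !oddM !modn2 !oddD !oddb; by_parity.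
Qed.

Lemma dE x : d x = (ftype x).2.
Proof. by []. Qed.

Lemma signrM_odd i m :
  (-1) ^+ (i * m)%N = (if odd m then (-1) ^+ i else 1) :> int.
Proof.
by rewrite -signr_odd oddM; case: (odd m); rewrite ?andbF ?andbT ?signr_odd.
Qed.

Theorem theorem5p2 (n : nat) (a : seq nat) (alpha : rat)
    (size_a : size a = n)
    (a_gt0 : forall j : nat, (1 <= j <= n)%N -> (0 < part a j)%N)
    (alphaE : alpha = contfrac a)
    (alpha01 : 0 < alpha < 1) :
  (n = 2%N ->
     t a 2 = (-1) ^+ part a 1 /\
     t a 1 = (-1) ^+ (part a 1 * part a 2 + part a 2 + 1)%N)
  /\
  ((3 <= n)%N ->
    (* (1) *)
    (ftype (alpha_ a (n - 2)) = T11 -> ftype (alpha_ a (n - 1)) = T10 ->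
       (forall j : nat, (1 <= j <= n - 1)%N ->
          t a j = (-1) ^+ (d (alpha_ a (j - 1)) * (part a n - 1))%N
                  * t (take (n - 1) a) j) /\
       t a n = t (take (n - 1) a) (n - 1))
    /\
    (* (2) *)
    (ftype (alpha_ a (n - 2)) = T01 -> ftype (alpha_ a (n - 1)) = T10 ->
       (forall j : nat, (1 <= j <= n - 1)%N ->
          t a j = (-1) ^+ (d (alpha_ a (j - 1)) * part a n)%N
                  * t (take (n - 1) a) j) /\
       t a n = - t (take (n - 1) a) (n - 1))
    /\
    (* (3) *)
    (ftype (alpha_ a (n - 2)) = T10 -> ftype (alpha_ a (n - 1)) = T01 ->
       (~~ odd (part a n) ->
          (forall j : nat, (1 <= j <= n - 1)%N ->
             t a j = t (take (n - 1) a) j) /\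
          t a n = - t (take (n - 1) a) (n - 1)) /\
       (odd (part a n) ->
          (forall j : nat, (1 <= j <= n - 2)%N ->
             t a j = (-1) ^+ d (alpha_ a (j - 1)) * t (take (n - 2) a) j) /\
          (forall j : nat, j = (n - 1)%N \/ j = n ->
             t a j = (-1) ^+ (part a (n - 1) - 1)%N
                     * t (take (n - 2) a) (n - 2))))
    /\
    (* (4) *)
    (ftype (alpha_ a (n - 2)) = T11 -> ftype (alpha_ a (n - 1)) = T01 ->
       (~~ odd (part a n) ->
          (forall j : nat, (1 <= j <= n - 2)%N ->
             t a j = t (take (n - 2) a) j) /\
          (forall j : nat, j = (n - 1)%N \/ j = n ->
             t a j = (-1) ^+ part a (n - 1) * t (take (n - 2) a) (n - 2))) /\
       (odd (part a n) ->
          (forall j : nat, (1 <= j <= n - 1)%N ->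
             t a j = t (take (n - 1) a) j) /\
          t a n = t (take (n - 1) a) (n - 1)))
    /\
    (* (5) *)
    (ftype (alpha_ a (n - 2)) = T01 -> ftype (alpha_ a (n - 1)) = T11 ->
       (forall j : nat, (1 <= j <= n - 2)%N ->
          t a j = t (take (n - 2) a) j) /\
       (forall j : nat, j = (n - 1)%N \/ j = n ->
          t a j = (-1) ^+ part a (n - 1) * t (take (n - 2) a) (n - 2)))
    /\
    (* (6) *)
    (ftype (alpha_ a (n - 2)) = T10 -> ftype (alpha_ a (n - 1)) = T11 ->
       (forall j : nat, (1 <= j <= n - 2)%N ->
          t a j = t (take (n - 2) a) j) /\
       (forall j : nat, j = (n - 1)%N \/ j = n ->
          t a j = (-1) ^+ part a (n - 1) * t (take (n - 2) a) (n - 2)))).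
Proof.
have {a_gt0} a_pos : all (leq 1) a.
  by apply/(all_nthP 0%N) => i lt_i; apply: (a_gt0 i.+1); rewrite -size_a.
split=> [n2 | n3].
  subst n.
  have E0 : ftype (alpha_ a 0) = T01 by rewrite alpha_continuant // take0.
  have lt1 : (1 < size a)%N by rewrite n2.
  have E1 : ftype (alpha_ a 1) = type_step T10 (part a 1) T01.
    have /alpha_pred_recur : (0 < size a)%N by exact: ltnW.
    by move=> /(_ a_pos) /= ->; rewrite ftype_oplus E0.
  have E2 := ftype_oplus (alpha_ a 0) (part a 2) (alpha_ a 1).
  rewrite -alpha_recur // E0 E1 in E2.
  rewrite !t_type_sign // ?(ltnW lt1) // n2 type_signSS /= /seifert_type.
  rewrite /path_type E0 E1 E2 -[_ ^+ part a 1]signr_odd.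
  rewrite -[_ ^+ (_ + _ + _)]signr_odd !oddD oddM /type_step.
  by case: (odd (part a 1)); case: (odd (part a 2)).
have [k Ek] : exists k, n = k.+3.
  by case: n n3 {size_a} => [|[|[|k]]] //; exists k.
rewrite {n n3}Ek !subSS !subn0 in size_a *.
have le2 : (k.+2 <= size a)%N by rewrite size_a.
have le1 : (k.+1 <= size a)%N by rewrite size_a ltnS ltnW.
(* The type of alpha_{n-3} governs the edge between Delta_{n-2} and
   Delta_{n-1}. *)
have T0 : ftype (alpha_ a k) =
    type_step (ftype (alpha_ a k.+2)) (part a k.+2) (ftype (alpha_ a k.+1)).
  by rewrite (alpha_recur (j := k)) // -ftype_oplus_back.
have T3 : ftype (alpha_ a k.+3) =
    type_step (ftype (alpha_ a k.+1)) (part a k.+3) (ftype (alpha_ a k.+2)).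
  by rewrite -ftype_oplus -alpha_recur // size_a.
have t3 j : (j <= k.+3)%N -> t a j = type_sign (path_type (alpha_ a k.+3)) a j.
  by move=> le_j; rewrite t_type_sign ?size_a.
have t2 j : (j <= k.+2)%N ->
    t (take k.+2 a) j = type_sign (path_type (alpha_ a k.+2)) a j.
  by move=> le_j; rewrite t_take.
have t1 j : (j <= k.+1)%N ->
    t (take k.+1 a) j = type_sign (path_type (alpha_ a k.+1)) a j.
  by move=> le_j; rewrite t_take.
have a2_gt0 := part_gt0 a_pos le2.
have a3_gt0 : (0 < part a k.+3)%N by apply: part_gt0; rewrite ?size_a.
have odd_a2 : odd (part a k.+2 - 1) = ~~ odd (part a k.+2).
  by rewrite oddB ?addbT.
have odd_a3 : odd (part a k.+3 - 1) = ~~ odd (part a k.+3).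
  by rewrite oddB ?addbT.
(* If the ends of the last edge are not both admissible, then the last two
   signs agree. *)
have tail j c : type_sign (path_type (alpha_ a k.+3)) a k.+2 = c ->
    ~~ (seifert_type (path_type (alpha_ a k.+3)) (alpha_ a k.+1) &&
        seifert_type (path_type (alpha_ a k.+3)) (alpha_ a k.+2)) ->
    j = k.+2 \/ j = k.+3 -> t a j = c.
  by move=> <- /negPf off [] ->; rewrite t3 // type_signSS off.
split; [|split; [|split; [|split; [|split]]]] => H1 H2;
  rewrite H1 H2 in T0 T3; rewrite /path_type H1 H2 T3 in t1 t2 t3 tail.
- split=> [j /andP[j_gt0 le_j]|].
    rewrite t3 1?leqW // t2 // signrM_odd odd_a3 /type_step.
    case: (odd (part a k.+3)); rewrite ?mul1r //= -type_sign_compare // j_gt0.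
    exact: leq_trans le_j le2.
  rewrite t3 // t2 // type_signSS /seifert_type H1 H2 /type_step.
  case: (odd (part a k.+3)) => //=.
  rewrite type_sign_compare // subn1 dE H1.
  by rewrite expr1 mulN1r opprK.
- split=> [j /andP[j_gt0 le_j]|].
    rewrite t3 1?leqW // t2 // signrM_odd /type_step.
    case: (odd (part a k.+3)); rewrite ?mul1r //= -type_sign_compare // j_gt0.
    exact: leq_trans le_j le2.
  rewrite t3 // t2 // type_signSS /seifert_type H1 H2 /type_step.
  case: (odd (part a k.+3)) => //=.
  rewrite type_sign_compare // subn1 dE H1.
  by rewrite expr1 mulN1r.
- split=> [/negPf even_a | odd_a].
    split=> [j /andP[j_gt0 le_j]|].
      by rewrite t3 1?leqW // t2 // /type_step even_a.
    by rewrite t3 // t2 // type_signSS /seifert_type H1 H2 /type_step even_a.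
  split=> [j /andP[j_gt0 le_j]|j].
    rewrite t3 ?(leqW (leqW le_j)) // t1 // /type_step odd_a /=.
    rewrite type_sign_compare // j_gt0.
    exact: leq_trans le_j le1.
  apply: tail; rewrite /seifert_type ?H1 ?H2 /type_step odd_a //= type_signSS.
  rewrite /seifert_type T0 H1 t1 // -signr_odd odd_a2.
  rewrite type_sign_compare // subn1 dE T0 /type_step.
  by case: (odd (part a k.+2)); rewrite /= ?expr0 ?expr1 ?mulN1r ?mul1r ?opprK.
- split=> [/negPf even_a | odd_a].
    split=> [j /andP[j_gt0 le_j]|j].
      by rewrite t3 ?(leqW (leqW le_j)) // t1 // /type_step even_a.
    apply: tail; rewrite /seifert_type ?H1 ?H2 /type_step even_a //=.
    rewrite type_signSS /seifert_type T0 H1 t1 // -signr_odd /type_step.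
    by case: (odd (part a k.+2)); rewrite /= ?mulN1r ?mul1r.
  split=> [j /andP[j_gt0 le_j]|].
    by rewrite t3 1?leqW // t2 // /type_step odd_a.
  by rewrite t3 // t2 // type_signSS /seifert_type H1 H2 /type_step odd_a.
- have E3 : (if type_step T01 (part a k.+3) T11 == T11 then T11 else T01) = T01.
    by rewrite /type_step; case: (odd _).
  rewrite E3 in t3 tail.
  split=> [j /andP[j_gt0 le_j]|j].
    by rewrite t3 ?(leqW (leqW le_j)) // t1.
  apply: tail; rewrite /seifert_type ?H1 ?H2 //= type_signSS.
  rewrite /seifert_type T0 H1 t1 // -signr_odd /type_step.
  by case: (odd (part a k.+2)); rewrite /= ?mulN1r ?mul1r.
- have E3 : (if type_step T10 (part a k.+3) T11 == T11 then T11 else T01) = T01.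
    by rewrite /type_step; case: (odd _).
  rewrite E3 in t3 tail.
  split=> [j /andP[j_gt0 le_j]|j].
    by rewrite t3 ?(leqW (leqW le_j)) // t1.
  apply: tail; rewrite /seifert_type ?H1 ?H2 //= type_signSS.
  rewrite /seifert_type T0 H1 t1 // -signr_odd /type_step.
  by case: (odd (part a k.+2)); rewrite /= ?mulN1r ?mul1r.
Qed.
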